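(* Let $(M,g)$ be an $n$-dimensional semi-Riemann manifold, let $X$ be a $C^\infty$ vector field on $M$, let $f=\frac12 g(X,X)$, and let $F=\nabla X-g^{-1}\otimes g(\nabla X)$ be the associated $(1,1)$-tensor field. Consider the first-order (kinematic) system $$\frac{dx}{dt}=X(x).$$ 1) If $F=0$, then the kinematic system prolongs to the potential dynamical system with $n$ degrees of freedom $$\frac{\nabla}{dt}\frac{dx}{dt}=\operatorname{grad} f .$$ 2) If $F\neq 0$, then the kinematic system prolongs to the non-potential dynamical system with $n$ degrees of freedom $$\frac{\nabla}{dt}\frac{dx}{dt}=\operatorname{grad} f+F\left(\frac{dx}{dt}\right).$$
   Context: A semi-Riemann metric $g$ on $M$ is a $C^\infty$ symmetric $(0,2)$-tensor field that is a nondegenerate inner product on each tangent space, of some signature $(r,s)$. $\nabla$ is the Levi-Civita connection of $g$, $\frac{\nabla}{dt}$ is covariant differentiation along a curve, and $\operatorname{grad}$ is the gradient with respect to $g$. In local coordinates (summation convention), $F$ has components $$F_j{}^i=\nabla_jX^i-g^{ih}g_{kj}\nabla_hX^k,\qquad F(v)^i=F_j{}^iv^j .$$ A first-order system prolongs to a second-order system if every solution of the first-order system is also a solution of the second-order system. A second-order system on the $n$-dimensional manifold $M$ (a dynamical system with $n$ degrees of freedom) is called potential if it has the form $\frac{\nabla}{dt}\frac{dx}{dt}=\operatorname{grad}\varphi$ for a function $\varphi$ on $M$, and non-potential otherwise. *)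

(* Defs.v *)
From HB Require Import structures.
From mathcomp Require Import all_boot all_order all_algebra.
From mathcomp Require Import boolp classical_sets functions reals topology.
From mathcomp Require Import normedtype derive ring.

Set Implicit Arguments.
Unset Strict Implicit.
Unset Printing Implicit Defensive.

Import Order.TTheory GRing.Theory Num.Theory.
Import numFieldNormedType.Exports.

Local Open Scope classical_set_scope.
Local Open Scope ring_scope.

(* Points of R^n and tangent vectors are row vectors.  Accordingly a (1,1)-     *)
(* tensor T_j^i is the matrix with entry T_j^i in row j and column i, and it    *)
(* acts on a vector v by v *m T.                                                *)

Section Smooth.
Variables (R : realType) (n : nat).

Definition iter_partial (s : seq 'I_n) (h : 'rV[R]_n -> R) : 'rV[R]_n -> R :=
  foldr (fun i k => 'D_(delta_mx 0 i) k) h s.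

(* C^oo on U (used with U open): the partial derivatives of all orders,         *)
(* including h itself (s = [::]), are Frechet differentiable, and in particular *)
(* continuous, at every point of U.                                             *)
Definition smooth_on (U : set 'rV[R]_n) (h : 'rV[R]_n -> R) : Prop :=
  forall (s : seq 'I_n) (x : 'rV[R]_n), U x -> differentiable (iter_partial s h) x.

End Smooth.

(* The map chart_coord is a homeomorphism from the open set chart_dom onto the  *)
(* open set chart_img, with inverse chart_param; the values of chart_coord off  *)
(* chart_dom and of chart_param off chart_img are irrelevant.                   *)
Record chart (R : realType) (n : nat) (T : topologicalType) := Chart {
  chart_dom : set T;
  chart_img : set 'rV[R]_n;
  chart_coord : T -> 'rV[R]_n;
  chart_param : 'rV[R]_n -> T;
  open_chart_dom : open chart_dom;
  open_chart_img : open chart_img;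
  chart_coord_img : forall p, chart_dom p -> chart_img (chart_coord p);
  chart_param_dom : forall x, chart_img x -> chart_dom (chart_param x);
  chart_coordK : forall p, chart_dom p -> chart_param (chart_coord p) = p;
  chart_paramK : forall x, chart_img x -> chart_coord (chart_param x) = x;
  chart_coord_cont : {within chart_dom, continuous chart_coord};
  chart_param_cont : {within chart_img, continuous chart_param} }.

Record manifold (R : realType) (n : nat) := Manifold {
  manifold_space :> topologicalType;
  manifold_hausdorff : hausdorff_space manifold_space;
  manifold_second_countable : @second_countable manifold_space;
  chart_index : Type;
  atlas : chart_index -> chart R n manifold_space;
  atlas_cover : forall p : manifold_space,
    exists a : chart_index, chart_dom (atlas a) p;
  atlas_compat : forall (a b : chart_index) (j : 'I_n),
    smooth_on
      (chart_coord (atlas a) @` (chart_dom (atlas a) `&` chart_dom (atlas b)))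
      (fun x => chart_coord (atlas b) (chart_param (atlas a) x) 0 j) }.

Section Manifold.
Variables (R : realType) (n : nat) (M : manifold R n).
Implicit Types (a b : chart_index M) (p : M) (i j k l h : 'I_n).

Definition in_chart a p : Prop := chart_dom (atlas a) p.

Definition chart_at p : chart_index M := sval (cid (atlas_cover p)).

Definition smooth_in_chart a (phi : M -> R) : Prop :=
  smooth_on (chart_img (atlas a)) (phi \o chart_param (atlas a)).

Definition smooth_fun (phi : M -> R) : Prop := forall a, smooth_in_chart a phi.

(* The partial derivative of phi at p with respect to the i-th coordinate of    *)
(* the chart a.                                                                 *)
Definition partial a i (phi : M -> R) p : R :=
  'D_(delta_mx 0 i) (phi \o chart_param (atlas a)) (chart_coord (atlas a) p).

(* Entry (i, j) is dy^j/dx^i, for x the coordinates of a and y those of b.      *)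
Definition transition_jacobian a b p : 'M[R]_n :=
  \matrix_(i, j) partial a i (fun q => chart_coord (atlas b) q 0 j) p.

(* Tensor fields are given by their components in every chart of the atlas,     *)
(* subject to the usual transformation law; the components in the chart a are   *)
(* only meaningful at points of the domain of a.                                *)
Record vector_field := VectorField {
  vf_comp : chart_index M -> M -> 'rV[R]_n;
  vf_smooth : forall a j, smooth_in_chart a (fun p => vf_comp a p 0 j);
  vf_law : forall a b p, in_chart a p -> in_chart b p ->
    vf_comp b p = vf_comp a p *m transition_jacobian a b p }.

Definition has_signature (r s : nat) (A : 'M[R]_n) : Prop :=
  (r + s = n)%N /\
  exists2 P : 'M[R]_n, P \in unitmx &
    P *m A *m P^T = diag_mx (\row_(j < n) (if (j < r)%N then 1 else -1)).

Record semi_riemann_metric := SemiRiemannMetric {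
  met_comp : chart_index M -> M -> 'M[R]_n;
  met_smooth : forall a i j, smooth_in_chart a (fun p => met_comp a p i j);
  met_law : forall a b p, in_chart a p -> in_chart b p ->
    met_comp a p = transition_jacobian a b p *m met_comp b p
                     *m (transition_jacobian a b p)^T;
  met_sym : forall a p, in_chart a p -> (met_comp a p)^T = met_comp a p;
  met_nondeg : forall a p, in_chart a p -> met_comp a p \in unitmx;
  met_signature : exists r s : nat,
    forall a p, in_chart a p -> has_signature r s (met_comp a p) }.

Variables (g : semi_riemann_metric).
Implicit Types (X : vector_field).

Local Notation "g_[ a , i , j ]" := (fun p => met_comp g a p i j).

Definition met_inv a p : 'M[R]_n := invmx (met_comp g a p).

(* g(X, X), computed in any chart around the point *)
Definition sqnorm X p : R :=
  let a := chart_at p in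
  \sum_i \sum_j met_comp g a p i j * vf_comp X a p 0 i * vf_comp X a p 0 j.

Definition energy X p : R := 2^-1 * sqnorm X p.

(* The Levi-Civita connection of g, through its Christoffel symbols             *)
(* Gamma^i_{jk} = 1/2 g^{il} (d_j g_{lk} + d_k g_{lj} - d_l g_{jk}).            *)
(* Lemmas christoffel_sym and christoffel_metric below check its two defining   *)
(* properties: it is torsion-free and it preserves g.                           *)
Definition christoffel a p i j k : R :=
  2^-1 * \sum_l met_inv a p i l *
    (partial a j g_[a, l, k] p + partial a k g_[a, l, j] p
     - partial a l g_[a, j, k] p).

Lemma partial_met_sym a p i j k : in_chart a p ->
  partial a k g_[a, i, j] p = partial a k g_[a, j, i] p.
Proof.
move=> ap; rewrite /partial; apply: near_eq_derive.
have : nbhs (chart_coord (atlas a) p) (chart_img (atlas a)).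
  by apply: open_nbhs_nbhs; split; [exact: open_chart_img | exact: chart_coord_img].
apply: filterS => x ix /=.
by rewrite -[in LHS](met_sym g (chart_param_dom ix)) mxE.
Qed.

Lemma christoffel_sym a p i j k : in_chart a p ->
  christoffel a p i j k = christoffel a p i k j.
Proof.
move=> ap; rewrite /christoffel; congr (_ * _); apply: eq_bigr => l _.
by rewrite (partial_met_sym j k l ap) [X in X - _]addrC.
Qed.

Lemma christoffel_metric a p i j k : in_chart a p ->
  partial a k g_[a, i, j] p =
  \sum_l (christoffel a p l k i * met_comp g a p l j
          + christoffel a p l k j * met_comp g a p i l).
Proof.
move=> ap.
pose c i j k := partial a j g_[a, i, k] p + partial a k g_[a, i, j] p
                - partial a i g_[a, j, k] p.
have low u v w :
    \sum_l christoffel a p l v w * met_comp g a p l u = 2^-1 * c u v w.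
  rewrite /christoffel; under eq_bigr do rewrite -mulrA mulr_suml.
  rewrite -mulr_sumr exchange_big /=; congr (_ * _).
  transitivity (\sum_l (l == u)%:R * c l v w).
    apply: eq_bigr => m _; under eq_bigr do rewrite mulrAC.
    rewrite -mulr_suml; congr (_ * _).
    have := mulVmx (met_nondeg g ap) => /matrixP /(_ m u); rewrite !mxE => <-.
    have gs : (met_inv a p)^T = met_inv a p by rewrite /met_inv trmx_inv met_sym.
    by apply: eq_bigr => q _; rewrite -[in LHS]gs mxE.
  by rewrite (bigD1 u) //= eqxx mul1r big1 ?addr0 // => l /negbTE ->; rewrite mul0r.
rewrite big_split /= low.
under [X in _ + X]eq_bigr do rewrite -(met_sym g ap) mxE.
rewrite low /c (partial_met_sym j i k ap) (partial_met_sym i k j ap).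
by rewrite (partial_met_sym k j i ap); field.
Qed.

(* Entry (j, i) is nabla_j X^i = d_j X^i + Gamma^i_{jk} X^k. *)
Definition nabla X a p : 'M[R]_n :=
  \matrix_(j, i) (partial a j (fun q => vf_comp X a q 0 i) p
                  + \sum_k christoffel a p i j k * vf_comp X a p 0 k).

(* Entry (j, i) is F_j^i = nabla_j X^i - g^{ih} g_{kj} nabla_h X^k. *)
Definition Ftensor X a p : 'M[R]_n :=
  \matrix_(j, i) (nabla X a p j i
     - \sum_h \sum_k met_inv a p i h * met_comp g a p k j * nabla X a p h k).

Definition Ftensor_eq0 X : Prop := forall a p, in_chart a p -> Ftensor X a p = 0.

Definition grad (phi : M -> R) a p : 'rV[R]_n :=
  \row_i \sum_h met_inv a p i h * partial a h phi p.

Section Curves.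
Implicit Types (x : R -> M) (t : R).

Definition velocity x a t : 'rV[R]_n :=
  \row_i derive1 (fun s => chart_coord (atlas a) (x s) 0 i) t.

(* Covariant derivative along the curve x of a vector field V along x, the      *)
(* latter given by its components in every chart.                               *)
Definition covariant_derivative x (V : chart_index M -> R -> 'rV[R]_n) a t :
  'rV[R]_n :=
  \row_i (derive1 (fun s => V a s 0 i) t
    + \sum_j \sum_k christoffel a (x t) i j k * velocity x a t 0 j * V a t 0 k).

(* Without continuity, chart_coord could be evaluated off the domain of the     *)
(* chart arbitrarily close to t.                                                *)
Definition differentiable_curve (J : set R) x : Prop :=
  forall t, J t -> {for t, continuous x} /\
    forall a, in_chart a (x t) ->
      forall i, derivable (fun s => chart_coord (atlas a) (x s) 0 i) t 1.

Definition open_interval (J : set R) : Prop :=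
  [/\ open J, is_interval J & J !=set0].

(* dx/dt = X(x) on J *)
Definition solution1 X (J : set R) x : Prop :=
  differentiable_curve J x /\
  forall t a, J t -> in_chart a (x t) -> velocity x a t = vf_comp X a (x t).

(* A second-order system nabla/dt dx/dt = G(x, dx/dt) is given by its right-    *)
(* hand side: G a p v are the components in the chart a of G at the point p and *)
(* the velocity with components v.                                              *)
Definition system2 := chart_index M -> M -> 'rV[R]_n -> 'rV[R]_n.

Definition solution2 (G : system2) (J : set R) x : Prop :=
  differentiable_curve J x /\
  forall t a, J t -> in_chart a (x t) ->
    (forall i, derivable (fun s => velocity x a s 0 i) t 1) /\
    covariant_derivative x (velocity x) a t = G a (x t) (velocity x a t).

Definition prolongs X (G : system2) : Prop :=
  forall (J : set R) x, open_interval J -> solution1 X J x -> solution2 G J x.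

(* nabla/dt dx/dt = grad phi *)
Definition grad_system (phi : M -> R) : system2 := fun a p _ => grad phi a p.

(* nabla/dt dx/dt = grad phi + F(dx/dt) *)
Definition grad_F_system (phi : M -> R) X : system2 :=
  fun a p v => grad phi a p + v *m Ftensor X a p.

Definition potential (G : system2) : Prop :=
  exists2 phi : M -> R, smooth_fun phi &
    forall a p v, in_chart a p -> G a p v = grad_system phi a p v.

End Curves.
End Manifold.

(* Main.v *)
Require Import Defs.
From mathcomp Require Import all_boot all_order all_algebra reals.
From mathcomp Require Import boolp classical_sets functions topology.
From mathcomp Require Import normedtype landau derive ring.

(** Along an integral curve of X the acceleration is nabla_X X.  Since nabla
    preserves g, df = g(nabla X, X); raising the index gives
    (grad f)^i = g^{ih} g_{kj} X^j nabla_h X^k, which is exactly the term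
    subtracted in F(X), so nabla_X X = grad f + F(X).  If grad f + F(v) were
    equal to grad phi for every velocity v, comparing v with 0 would give
    F(v) = 0 for all v. *)

Set Implicit Arguments.
Unset Strict Implicit.
Unset Printing Implicit Defensive.

Import Order.TTheory GRing.Theory Num.Theory.
Import numFieldNormedType.Exports.

Local Open Scope classical_set_scope.
Local Open Scope ring_scope.

(** * Smooth functions on an open subset of R^n *)

(** Differentiability is local: the expansion of [f] at [x] is also one of [h], and by uniqueness of
    the continuous linear part ['d f x] is the differential of [h]. *)
Lemma near_eq_differentiable (R : numFieldType) (V W : normedModType R)
    (f h : V -> W) (x : V) :
  (\near x, f x = h x) -> differentiable f x -> differentiable h x.
Proof.
move=> fh df.
have expansion : h \o shift x = cst (h x) + 'd f x +o_ 0 id.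
  apply/eqaddoP => e e_gt0.
  have /eqaddoP /(_ e e_gt0) := diff_locally df.
  have : \forall y \near (0 : V), (f \o shift x) y = (h \o shift x) y.
    move: fh; rewrite (near_shift 0) subr0; exact: filterS.
  apply: filterS2 => y /= fhy; rewrite !fctE /= in fhy *.
  by rewrite -fhy -(nbhs_singleton fh).
have dfc : continuous ('d f x) by exact: diff_continuous.
by apply/diff_locallyP; rewrite (diff_unique dfc expansion).
Qed.

Section SmoothClosure.
Variables (R : realType) (n : nat) (U : set 'rV[R]_n).
Implicit Types f h : 'rV[R]_n -> R.

(** Grading smoothness by order, instead of by words of partial derivatives, lets the Leibniz rule
    be handled by a plain induction on the order. *)
Fixpoint differentiable_upto (k : nat) f : Prop :=
  (forall x, U x -> differentiable f x) /\
  if k is k'.+1 then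
    forall i, differentiable_upto k' ('D_(delta_mx 0 i) f)
  else True.

Lemma smooth_onP f : smooth_on U f <-> forall k, differentiable_upto k f.
Proof.
split=> [sf k | df s].
  elim: k f sf => [|k IH] f sf; split=> //; try exact: (sf [::]).
  by move=> i; apply: IH => s x Ux; have := sf (rcons s i) x Ux;
    rewrite /iter_partial foldr_rcons.
(* [foldr] applies the last letter of [s] first, so the induction peels words from the right. *)
move: (df (size s)) => {df}; elim/last_ind: s f => [|s i IH] f.
  by case.
by rewrite size_rcons => -[_ /(_ i) /IH dfi] x /dfi; rewrite /iter_partial foldr_rcons.
Qed.

Lemma differentiable_uptoW k f :
  differentiable_upto k.+1 f -> differentiable_upto k f.
Proof.
elim: k f => [|k IH] f [df dfi]; split=> // i; exact: IH (dfi i).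
Qed.

Hypothesis openU : open U.

Lemma open_near_eq f h x : (forall y, U y -> f y = h y) -> U x ->
  \near x, f x = h x.
Proof.
move=> fh Ux; have : nbhs x U by exact: open_nbhs_nbhs.
exact: filterS.
Qed.

(** Since [U] is open, equality on [U] is equality near each of its points and so passes to partial
    derivatives. The sum and product rules for derivatives are available only on [U], so this lemma
    carries them through the inductions below. *)
Lemma differentiable_upto_eq k f h : (forall x, U x -> f x = h x) ->
  differentiable_upto k f -> differentiable_upto k h.
Proof.
elim: k f h => [|k IH] f h fh [df dfi]; split=> //.
- by move=> x Ux; exact: near_eq_differentiable (open_near_eq fh Ux) (df x Ux).
- by move=> x Ux; exact: near_eq_differentiable (open_near_eq fh Ux) (df x Ux).
- move=> i; apply: IH (dfi i) => x Ux; exact/near_eq_derive/open_near_eq.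
Qed.

Lemma differentiable_uptoD k f h : differentiable_upto k f ->
  differentiable_upto k h -> differentiable_upto k (f + h).
Proof.
elim: k f h => [|k IH] f h [df dfi] [dh dhi]; split=> //.
- by move=> x Ux; apply: differentiableD; [exact: df | exact: dh].
- by move=> x Ux; apply: differentiableD; [exact: df | exact: dh].
- move=> i; apply: differentiable_upto_eq (IH _ _ (dfi i) (dhi i)) => x Ux.
  by rewrite deriveD //; apply: diff_derivable; [exact: df | exact: dh].
Qed.

Lemma differentiable_uptoM k f h : differentiable_upto k f ->
  differentiable_upto k h -> differentiable_upto k (f * h).
Proof.
elim: k f h => [|k IH] f h uf uh; have [df dfi] := uf; have [dh dhi] := uh; split=> //.
- by move=> x Ux; apply: differentiableM; [exact: df | exact: dh].
- by move=> x Ux; apply: differentiableM; [exact: df | exact: dh].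
- move=> i; apply: (@differentiable_upto_eq _
    (f * 'D_(delta_mx 0 i) h + h * 'D_(delta_mx 0 i) f)).
    by move=> x Ux; rewrite deriveM //; apply: diff_derivable; [exact: df | exact: dh].
  (* Each Leibniz term keeps one undifferentiated factor, known to order [k.+1];
     [differentiable_uptoW] lowers it to order [k]. *)
  by apply: differentiable_uptoD; apply: IH;
    first [exact: dfi | exact: dhi | exact: differentiable_uptoW].
Qed.

Lemma differentiable_upto_cst k (c : R) : differentiable_upto k (cst c).
Proof.
elim: k c => [|k IH] c; split=> // i.
by apply: differentiable_upto_eq (IH 0) => x _; rewrite derive_cst.
Qed.

Lemma smooth_on_eq f h : (forall x, U x -> f x = h x) ->
  smooth_on U f -> smooth_on U h.
Proof.
by move=> fh /smooth_onP sf; apply/smooth_onP => k; exact: differentiable_upto_eq (sf k).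
Qed.

Lemma smooth_onM f h : smooth_on U f -> smooth_on U h -> smooth_on U (f * h).
Proof.
move=> /smooth_onP sf /smooth_onP sh; apply/smooth_onP => k.
exact: differentiable_uptoM.
Qed.

Lemma smooth_on_cst (c : R) : smooth_on U (cst c).
Proof. by apply/smooth_onP => k; exact: differentiable_upto_cst. Qed.

Lemma smooth_on_sum (I : Type) (r : seq I) (F : I -> 'rV[R]_n -> R) :
  (forall i, smooth_on U (F i)) -> smooth_on U (\sum_(i <- r) F i).
Proof.
move=> sF; elim/big_ind: _ => [|f h /smooth_onP sf /smooth_onP sh|i _] //.
  exact: smooth_on_cst.
by apply/smooth_onP => k; exact: differentiable_uptoD.
Qed.

End SmoothClosure.

(** * The energy in a fixed chart *)

Section SemiRiemann.
Variables (R : realType) (n : nat) (M : manifold R n).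
Variables (g : semi_riemann_metric M) (X : vector_field M).
Implicit Types (a b : chart_index M) (p : M) (i j k l h : 'I_n).

Lemma nbhs_chart_img a p : in_chart a p ->
  nbhs (chart_coord (atlas a) p) (chart_img (atlas a)).
Proof.
move=> ap; apply: open_nbhs_nbhs; split; first exact: open_chart_img.
exact: chart_coord_img.
Qed.

Lemma smooth_in_chart_differentiable a p (phi : M -> R) : in_chart a p ->
  smooth_in_chart a phi ->
  differentiable (phi \o chart_param (atlas a)) (chart_coord (atlas a) p).
Proof. by move=> ap sphi; apply: (sphi [::]); exact: chart_coord_img. Qed.

Lemma eq_partial a p i (phi psi : M -> R) : in_chart a p ->
  (forall q, in_chart a q -> phi q = psi q) ->
  partial a i phi p = partial a i psi p.
Proof.
move=> ap eqphi; apply: near_eq_derive; have := nbhs_chart_img ap.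
by apply: filterS => x xa; apply: eqphi; exact: chart_param_dom.
Qed.

Definition metric_form a p (v w : 'rV[R]_n) : R :=
  \sum_i \sum_j met_comp g a p i j * v 0 i * w 0 j.

Lemma metric_formE a p v w :
  metric_form a p v w = (v *m met_comp g a p *m w^T) 0 0.
Proof.
rewrite mxE /metric_form exchange_big /=; apply: eq_bigr => j _.
by rewrite !mxE mulr_suml; apply: eq_bigr => i _; rewrite [_ * v 0 i]mulrC.
Qed.

(** [sqnorm] uses a chart chosen separately at each point. With J the transition Jacobian, X_b = X_a
    J and G_a = J G_b J^T, so X_b G_b X_b^T = X_a G_a X_a^T and any chart around the point will
    do. *)
Lemma sqnorm_chart a p : in_chart a p ->
  sqnorm g X p = metric_form a p (vf_comp X a p) (vf_comp X a p).
Proof.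
move=> ap; have bp : in_chart (chart_at p) p by exact: svalP (cid (atlas_cover p)).
rewrite -[LHS]/(metric_form (chart_at p) p _ _) !metric_formE.
by rewrite (vf_law X ap bp) (met_law g ap bp) trmx_mul !mulmxA.
Qed.

Lemma energy_chart a p : in_chart a p ->
  energy g X p =
  2^-1 * \sum_i \sum_j met_comp g a p i j * vf_comp X a p 0 i * vf_comp X a p 0 j.
Proof. by move=> ap; rewrite /energy (sqnorm_chart ap). Qed.

Lemma smooth_energy : smooth_fun (energy g X).
Proof.
move=> a; have oU := @open_chart_img _ _ _ (atlas a).
pose G i j x := met_comp g a (chart_param (atlas a) x) i j.
pose V i x := vf_comp X a (chart_param (atlas a) x) 0 i.
(* In one fixed chart the energy is a polynomial in the smooth components of [g] and [X]. *)
apply: (@smooth_on_eq _ _ _ oU (cst 2^-1 * \sum_i \sum_j G i j * V i * V j)).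
  move=> x xa; rewrite /= (energy_chart (chart_param_dom xa)).
  rewrite !fctE !fct_sumE; congr (_ * _); apply: eq_bigr => i _.
  by rewrite fct_sumE.
apply: smooth_onM => //; first exact: smooth_on_cst.
apply: smooth_on_sum => // i; apply: smooth_on_sum => // j.
by do 2?[apply: smooth_onM => //];
  [exact: met_smooth | exact: vf_smooth | exact: vf_smooth].
Qed.

(** * The differential of the energy *)

Lemma partial_energy_product_rule a p h : in_chart a p ->
  partial a h (energy g X) p =
  2^-1 * \sum_i \sum_j
    (partial a h (fun q => met_comp g a q i j) p * vf_comp X a p 0 i * vf_comp X a p 0 j
     + met_comp g a p i j * partial a h (fun q => vf_comp X a q 0 i) p * vf_comp X a p 0 j
     + met_comp g a p i j * vf_comp X a p 0 i * partial a h (fun q => vf_comp X a q 0 j) p).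
Proof.
(* The fixed-chart formula must replace the energy on the whole chart domain before differentiating,
   since [chart_at] may vary from point to point. *)
move=> ap; rewrite (eq_partial h ap (@energy_chart a)) /partial.
pose G i j x := met_comp g a (chart_param (atlas a) x) i j.
pose V i x := vf_comp X a (chart_param (atlas a) x) 0 i.
set c := chart_coord _ _; set e := delta_mx _ _.
have dG i j : derivable (G i j) c e.
  apply: diff_derivable.
  exact: smooth_in_chart_differentiable ap (@met_smooth _ _ _ g a i j).
have dV i : derivable (V i) c e.
  apply: diff_derivable.
  exact: smooth_in_chart_differentiable ap (@vf_smooth _ _ _ X a i).
have dGVV i j : derivable (G i j * V i * V j) c e by do 2?[apply: derivableM => //].
have pc : chart_param (atlas a) c = p by exact: chart_coordK.
rewrite (_ : _ \o _ = 2^-1 \*o \sum_i \sum_j G i j * V i * V j); last first.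
  rewrite !fct_sumE; apply/funext => x /=; congr (_ * _).
  by apply: eq_bigr => i _; rewrite fct_sumE.
rewrite deriveMl => [|]; last by apply: derivable_sum => i; exact: derivable_sum.
rewrite derive_sum => [|i]; last exact: derivable_sum.
congr (_ * _); apply: eq_bigr => i _; rewrite derive_sum //.
apply: eq_bigr => j _; rewrite !deriveM //; last exact: derivableM.
rewrite !fctE /G /V pc /GRing.scale /= -/(G i j) -/(V i) -/(V j).
rewrite /comp -/(G i j) -/(V i) -/(V j).
by ring.
Qed.

Lemma met_compC a p i j : in_chart a p -> met_comp g a p i j = met_comp g a p j i.
Proof. by move=> ap; rewrite -[in LHS](met_sym g ap) mxE. Qed.

Lemma met_invC a p i j : in_chart a p -> met_inv g a p i j = met_inv g a p j i.
Proof.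
move=> ap; have gs : (met_inv g a p)^T = met_inv g a p.
  by rewrite /met_inv trmx_inv met_sym.
by rewrite -[in LHS]gs mxE.
Qed.

(** This is d_h f = g(nabla_h X, X). Metric compatibility turns d_h g_{ij} into two Christoffel
    terms; by symmetry of [g] these contribute equally, as do the two terms differentiating X, and
    the doubling cancels the factor 1/2. *)
Lemma partial_energy a p h : in_chart a p ->
  partial a h (energy g X) p =
  \sum_i \sum_j met_comp g a p i j * nabla g X a p h i * vf_comp X a p 0 j.
Proof.
move=> ap; rewrite partial_energy_product_rule //.
set V := vf_comp X a p; set G := met_comp g a p.
pose dV i := partial a h (fun q => vf_comp X a q 0 i) p.
pose Gam i j k := christoffel g a p i j k.
(* [S] is the coordinate-derivative part of g(nabla_h X, X), and [T] its Christoffel part. *)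
pose S := \sum_i \sum_j G i j * dV i * V 0 j.
pose T := \sum_i \sum_j \sum_l Gam l h i * G l j * V 0 i * V 0 j.
have TE : T = \sum_i \sum_j \sum_k G i j * Gam i h k * V 0 k * V 0 j.
  rewrite /T exchange_big [RHS]exchange_big /=; apply: eq_bigr => j _.
  rewrite exchange_big /=; apply: eq_bigr => i _.
  by apply: eq_bigr => k _; rewrite [Gam _ _ _ * _]mulrC.
have -> : \sum_i \sum_j G i j * nabla g X a p h i * V 0 j = S + T.
  rewrite TE /S.
  rewrite -big_split; apply: eq_bigr => i _; rewrite -big_split; apply: eq_bigr => j _.
  rewrite mxE mulrDr mulrDl; congr (_ + _); rewrite mulr_sumr mulr_suml.
  by apply: eq_bigr => k _; rewrite !mulrA.
have sym_dV : \sum_i \sum_j G i j * V 0 i * dV j = S.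
  rewrite exchange_big; apply: eq_bigr => i _; apply: eq_bigr => j _.
  by rewrite /G met_compC // mulrAC.
have dG : \sum_i \sum_j
    partial a h (fun q => met_comp g a q i j) p * V 0 i * V 0 j = T + T.
  (* The two terms of [christoffel_metric] differ by exchanging i and j, so the second copy of [T]
     is summed in the opposite order. *)
  rewrite /T [X in _ = _ + X]exchange_big -big_split.
  apply: eq_bigr => i _; rewrite -big_split; apply: eq_bigr => j _ /=.
  rewrite (christoffel_metric g i j h ap) !mulr_suml -big_split /=.
  apply: eq_bigr => l _; rewrite -/(Gam _ _ _) -/(Gam _ _ _) -/G.
  by rewrite (met_compC i l ap) -/G; ring.
under eq_bigr do rewrite 2!big_split /=.
by rewrite 2!big_split /= dG -/S sym_dV; field.
Qed.

(** * The gradient of the energy and the tensor F *)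

Lemma grad_energy a p : in_chart a p ->
  grad g (energy g X) a p =
  vf_comp X a p *m met_comp g a p *m (nabla g X a p)^T *m met_inv g a p.
Proof.
move=> ap; apply/rowP => i; rewrite !mxE; apply: eq_bigr => h _.
rewrite met_invC // mulrC partial_energy // mxE; congr (_ * _).
apply: eq_bigr => k _; rewrite !mxE mulr_suml; apply: eq_bigr => j _.
by rewrite met_compC // mulrAC [_ * vf_comp _ _ _ _ _]mulrC.
Qed.

(** In the row-vector convention, G A^T G^-1 is the adjoint of A with respect to [g]. Thus F is
    nabla X minus its adjoint, and [grad_energy] says that grad f is this adjoint applied to X. *)
Lemma FtensorE a p : in_chart a p ->
  Ftensor g X a p =
  nabla g X a p - met_comp g a p *m (nabla g X a p)^T *m met_inv g a p.
Proof.
move=> ap; apply/matrixP => j i; rewrite mxE [RHS]mxE; congr (_ + _).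
rewrite [RHS]mxE [in RHS]mxE; congr (- _); apply: eq_bigr => h _; rewrite !mxE mulr_suml.
apply: eq_bigr => k _; rewrite [in RHS]mxE met_invC // (met_compC k j ap).
by rewrite -mulrA mulrC.
Qed.

Lemma grad_energy_Ftensor a p : in_chart a p ->
  grad g (energy g X) a p + vf_comp X a p *m Ftensor g X a p =
  vf_comp X a p *m nabla g X a p.
Proof.
by move=> ap; rewrite grad_energy // FtensorE // mulmxBr !mulmxA addrC subrK.
Qed.

(** * Integral curves and their acceleration *)

Lemma open_interval_near (J : set R) t : open_interval J -> J t -> \forall s \near t, J s.
Proof. by move=> [oJ _ _] Jt; exact: open_nbhs_nbhs. Qed.

Lemma curve_near_chart (J : set R) (x : R -> M) t a :
  differentiable_curve J x -> J t -> in_chart a (x t) ->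
  \forall s \near t, in_chart a (x s).
Proof.
move=> dx Jt ax; have [xt _] := dx t Jt; apply: (xt (chart_dom (atlas a))).
by apply: open_nbhs_nbhs; split=> //; exact: open_chart_dom.
Qed.

(** The chain rule, read in the chart [a]. Continuity of the curve keeps it in the chart domain near
    [t], where [phi \o x] agrees with its coordinate expression. *)
Lemma is_derive_along_curve (J : set R) (x : R -> M) t a (phi : M -> R) :
  differentiable_curve J x -> J t -> in_chart a (x t) -> smooth_in_chart a phi ->
  is_derive t 1 (phi \o x) (\sum_j velocity x a t 0 j * partial a j phi (x t)).
Proof.
move=> dx Jt ax sphi; pose c s := chart_coord (atlas a) (x s).
pose phic := phi \o chart_param (atlas a).
have dc : derivable c t 1.
  by apply/derivable_mxP => i j; rewrite (ord1 i); exact: (dx t Jt).2.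
have diffc : differentiable c t by exact/derivable1_diffP.
have diffphi : differentiable phic (c t) by exact: smooth_in_chart_differentiable.
have velE : 'd c t 1 = velocity x a t.
  rewrite -deriveE // derive_mx //; apply/rowP => j.
  by rewrite !mxE derive1E.
apply: (@near_eq_is_derive _ _ _ (phic \o c)).
  have := curve_near_chart dx Jt ax; apply: filterS => s axs.
  by rewrite /phic /c /= chart_coordK.
have diff_comp_c : differentiable (phic \o c) t by exact: differentiable_comp.
apply: DeriveDef; first exact: diff_derivable.
(* Expanding the velocity in the standard basis turns the differential of [phic] into partial
   derivatives. *)
rewrite deriveE // diff_comp //= velE [velocity _ _ _ in LHS]row_sum_delta linear_sum.
by apply: eq_bigr => j _; rewrite linearZ /= -deriveE.
Qed.

(** A solution is only assumed differentiable once. Since [J] is open, the equation identifies its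
    velocity near [t] with the smooth field X along the curve, which yields the second
    derivative. *)
Lemma is_derive_velocity (J : set R) (x : R -> M) t a i :
  open_interval J -> solution1 X J x -> J t -> in_chart a (x t) ->
  is_derive t 1 (fun s => velocity x a s 0 i)
    (\sum_j vf_comp X a (x t) 0 j * partial a j (fun q => vf_comp X a q 0 i) (x t)).
Proof.
move=> oJ [dx velX] Jt ax.
apply: (@near_eq_is_derive _ _ _ ((fun q => vf_comp X a q 0 i) \o x)).
  near=> s; rewrite velX //; near: s.
  - exact: open_interval_near.
  - exact: curve_near_chart dx Jt ax.
by rewrite -velX //; apply: is_derive_along_curve dx Jt ax _; exact: vf_smooth.
Unshelve. all: by end_near. Qed.

(** The derivative of the velocity supplies X^j d_j X^i; with the velocity replaced by X, the
    Christoffel term completes it to X^j nabla_j X^i. *)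
Lemma covariant_derivative_velocity (J : set R) (x : R -> M) t a :
  open_interval J -> solution1 X J x -> J t -> in_chart a (x t) ->
  covariant_derivative g x (velocity x) a t =
  vf_comp X a (x t) *m nabla g X a (x t).
Proof.
move=> oJ sol Jt ax; apply/rowP => i; rewrite [LHS]mxE [RHS]mxE derive1E.
rewrite (@derive_val _ _ _ _ _ _ _ (is_derive_velocity i oJ sol Jt ax)).
rewrite -big_split; apply: eq_bigr => j _; rewrite [nabla _ _ _ _ _ _]mxE mulrDr.
congr (_ + _).
rewrite mulr_sumr; apply: eq_bigr => k _; rewrite sol.2 //.
by rewrite mulrAC mulrC.
Qed.

Lemma solution1_solution2 (J : set R) (x : R -> M) :
  open_interval J -> solution1 X J x ->
  solution2 g (grad_F_system g (energy g X) X) J x.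
Proof.
move=> oJ sol; split=> [|t a Jt ax]; first exact: sol.1.
split=> [i|]; first by have [] := is_derive_velocity i oJ sol Jt ax.
rewrite (covariant_derivative_velocity oJ sol Jt ax) /grad_F_system sol.2 //.
by rewrite grad_energy_Ftensor.
Qed.

End SemiRiemann.

Theorem mainTheorem1 (R : realType) (n : nat) (M : manifold R n)
    (g : semi_riemann_metric M) (X : vector_field M) :
  let f := energy g X in
  (Ftensor_eq0 g X ->
     prolongs g X (grad_system g f) /\ potential g (grad_system g f)) /\
  (~ Ftensor_eq0 g X ->
     prolongs g X (grad_F_system g f X) /\ ~ potential g (grad_F_system g f X)).
Proof.
move=> f; split=> [F0 | F_neq0]; split.
- move=> J x oJ sol; have [dx sol2] := solution1_solution2 g oJ sol.
  split=> // t a Jt ax; have [dv ->] := sol2 t a Jt ax.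
  by split=> //; rewrite /grad_F_system F0 // mulmx0 addr0.
- by exists f => //; exact: smooth_energy.
- by move=> J x; exact: solution1_solution2.
(* Basis velocities suffice: ['e_i *m F] is row [i] of F, and velocity 0 at the same point shows
   that grad f and grad phi agree there. *)
- case=> phi _ eq_grad; apply: F_neq0 => a p ap; apply/row_matrixP => i.
  have := eq_grad a p 'e_i ap; rewrite /grad_F_system /grad_system.
  have := eq_grad a p 0 ap; rewrite /grad_F_system /grad_system mul0mx addr0 => ->.
  by move=> /(canRL (addKr _)); rewrite addNr -rowE row0.
Qed.
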